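(* Let $X\subseteq U$ be a fixed set of $|X|=m$ keys and let $h:U\to[n]$ be a simple tabulation hash function. Then with high probability $$|h(X)|\ge n\left(1-\left(1-\frac1n\right)^{\Omega(m)}\right);$$ that is, for every constant $\gamma>0$ there is a constant $\beta>0$ (depending only on $\gamma$ and $c$) such that $|h(X)|\ge n\left(1-(1-1/n)^{m/\beta}\right)$ with probability at least $1-O(n^{-\gamma})$.
   Context: Simple tabulation hashing: the key universe is $U=[u]$, each key $x\in U$ is viewed as a vector $(x[0],\dots,x[c-1])$ of $c=O(1)$ characters from $\Sigma=[u^{1/c}]$; the range is $[n]=[2^r]$. $h(x)=h_0(x[0])\oplus\cdots\oplus h_{c-1}(x[c-1])$ with $h_0,\dots,h_{c-1}:\Sigma\to[2^r]$ independent fully random functions and $\oplus$ bitwise XOR. ''With high probability'' means with probability $1-O(n^{-\gamma})$ for any prescribed constant $\gamma>0$. *)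

(* Defs.v *)
From HB Require Import structures.
From mathcomp Require Import all_boot all_order all_algebra.
From mathcomp Require Import reals exp.
Set Implicit Arguments. Unset Strict Implicit. Unset Printing Implicit Defensive.
Import Order.TTheory GRing.Theory Num.Theory.

(* Keys: vectors of c characters from Sigma = [s] (so u = s^c). *)
Definition key (c s : nat) := {ffun 'I_c -> 'I_s}.
(* Hash values: elements of [2^r], represented by their r bits. *)
Definition hval (r : nat) := {ffun 'I_r -> bool}.
Definition hxor (r : nat) (a b : hval r) : hval r := [ffun j => xorb (a j) (b j)].
Definition hzero (r : nat) : hval r := [ffun _ => false].
Definition tables (c s r : nat) := {ffun 'I_c -> {ffun 'I_s -> hval r}}.
Definition tab_hash (c s r : nat) (T : tables c s r) (x : key c s) : hval r :=
  \big[@hxor r/hzero r]_(i < c) T i (x i).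
Definition himage (c s r : nat) (T : tables c s r) (X : {set key c s}) : {set hval r} :=
  [set tab_hash T x | x in X].
Definition tprob (R : realType) (c s r : nat) (E : pred (tables c s r)) : R :=
  (#|[set T : tables c s r | E T]|%:R / #|{: tables c s r}|%:R)%R.

(* Main.v *)
Require Import Defs.
From HB Require Import structures.
From mathcomp Require Import all_boot all_order all_algebra.
From mathcomp Require Import reals sequences exp.
From mathcomp Require Import zify ring lra.
Set Implicit Arguments. Unset Strict Implicit. Unset Printing Implicit Defensive.
Import Order.TTheory GRing.Theory Num.Theory.

(** Replacing one table entry [T p a] by its xor with a uniform value leaves the
    law of [T] unchanged and translates the hash values of exactly the keys with
    [x p = a].

    First, if more than [t ^ c] keys share a hash value, then [t + 1] of them
    differ pairwise in a common coordinate, so their hash values are independent;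
    a union bound shows that, with high probability, a set of at most
    [n ^ (1 - eps)] keys has image at least a constant fraction of its size. This
    settles small [m].

    For larger [m], all but at most half of the keys have a character shared by
    few keys, so for some coordinate [p] a constant fraction of the keys lies in
    fibers of [x |-> x p] of size at most [n ^ (1 - eps)]. Revealing the entries
    [T p a] one at a time, the image of the fiber of [a] is translated uniformly,
    so the number [E] of empty bins shrinks on average by a factor
    [1 - Omega(|fiber| / n)]. Following [E ^ q] instead of [E], with [q] a small
    power of [n], while [E] exceeds [q] times the fiber size, and applying
    Markov's inequality gives [E <= n exp (- Omega(m / n))] with high probability
    as long as [m = O(n log n)]. For [m] of larger order, Markov's inequality with
    [q = 1] shows that every bin is hit. *)

(** * Xor on hash values and cardinality tools *)

Lemma hxorA r : associative (@hxor r).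
Proof. by move=> a b d; apply/ffunP=> j; rewrite !ffunE; case: (a j); case: (b j); case: (d j). Qed.

Lemma hxorC r : commutative (@hxor r).
Proof. by move=> a b; apply/ffunP=> j; rewrite !ffunE; case: (a j); case: (b j). Qed.

Lemma hxor0l r : left_id (hzero r) (@hxor r).
Proof. by move=> a; apply/ffunP=> j; rewrite !ffunE; case: (a j). Qed.

HB.instance Definition _ r :=
  Monoid.isComLaw.Build (hval r) (hzero r) (@hxor r) (@hxorA r) (@hxorC r) (@hxor0l r).

Lemma hxorK r (v : hval r) : involutive (@hxor r ^~ v).
Proof. by move=> a; apply/ffunP=> j; rewrite !ffunE; case: (a j); case: (v j). Qed.

Lemma hxor_injr r (v : hval r) : injective (@hxor r ^~ v).
Proof. exact: can_inj (hxorK v). Qed.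

Lemma hxor_eq r (a b v : hval r) : (hxor a v == b) = (v == hxor b a).
Proof.
apply/eqP/eqP => [<-|->]; first by rewrite [hxor a v]hxorC hxorK.
by rewrite hxorC hxorK.
Qed.

Lemma card_hval r : #|{: hval r}| = 2 ^ r.
Proof. by rewrite card_ffun card_bool card_ord. Qed.

Lemma leq_card_bigcup (I T : finType) (P : pred I) (F : I -> {set T}) :
  #|\bigcup_(i | P i) F i| <= \sum_(i | P i) #|F i|.
Proof.
elim/big_ind2: _ => [|k A l B Ak Bl|//]; first by rewrite cards0.
exact: leq_trans (leq_card_setU A B).1 (leq_add Ak Bl).
Qed.

Lemma card_sum_pred (A : finType) (P : pred A) : #|[set x | P x]| = \sum_x P x.
Proof. by rewrite -sum1dep_card big_mkcond; apply: eq_bigr => x _; case: (P x). Qed.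

(** * Re-randomizing one table entry *)

Section Shift.
Variables c s r : nat.
Implicit Types (T : tables c s r) (x : key c s) (X Y : {set key c s}).
Implicit Types (p : 'I_c) (a : 'I_s) (v : hval r).

Definition shift p a v T : tables c s r :=
  [ffun i => [ffun b => if (i == p) && (b == a) then hxor (T i b) v else T i b]].

Lemma shiftK p a v : involutive (shift p a v).
Proof.
move=> T; apply/ffunP=> i; apply/ffunP=> b; rewrite !ffunE.
by case: (_ && _); rewrite ?hxorK.
Qed.

Lemma tab_hash_shift p a v T x :
  tab_hash (shift p a v T) x = if x p == a then hxor (tab_hash T x) v else tab_hash T x.
Proof.
rewrite /tab_hash (bigD1 p) //= [in RHS](bigD1 p) //= !ffunE eqxx /=.
rewrite (eq_bigr (fun i => T i (x i))); last first.
  by move=> i /negbTE ip; rewrite !ffunE ip.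
case: ifP => // _; first by rewrite -hxorA [hxor v _]hxorC hxorA.
Qed.

Lemma himage_shift_in p a v T Y : (forall x, x \in Y -> x p = a) ->
  himage (shift p a v T) Y = [set hxor w v | w in himage T Y].
Proof.
move=> Ya; rewrite /himage -imset_comp; apply: eq_in_imset => x /Ya xa /=.
by rewrite tab_hash_shift xa eqxx.
Qed.

Lemma himage_shift_notin p a v T Y : (forall x, x \in Y -> x p != a) ->
  himage (shift p a v T) Y = himage T Y.
Proof.
move=> Ya; apply: eq_in_imset => x /Ya xa /=.
by rewrite tab_hash_shift (negbTE xa).
Qed.

(** For fixed [v] the shift permutes the tables. The extra sum over [v] allows averaging over a
    fresh value of one entry. *)
Lemma big_shift (V : Type) (idx : V) (op : Monoid.com_law idx) p a (F : tables c s r -> V) :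
  \big[op/idx]_T \big[op/idx]_v F (shift p a v T) =
  \big[op/idx]_T \big[op/idx]_(v : hval r) F T.
Proof.
rewrite exchange_big [RHS]exchange_big /=; apply: eq_bigr => v _.
by rewrite [RHS](reindex_inj (can_inj (shiftK p a v))).
Qed.

(** Induction on [l]: randomizing [T p (x p)] moves the hash of [x] and of no other key of
    [x0 :: l], so exactly one [v] makes [x] collide with [x0]. *)
Lemma card_collision p x0 (l : seq (key c s)) :
  uniq [seq x p | x : key c s <- x0 :: l] ->
  #|[set T : tables c s r | all (fun x => tab_hash T x == tab_hash T x0) l]| * (2 ^ r) ^ size l
    = #|{: tables c s r}|.
Proof.
elim: l => [|x l IHl].
  by move=> _; rewrite muln1 -cardsT; apply: eq_card => T; rewrite !inE.
rewrite map_cons cons_uniq [size _]/= => /andP[].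
rewrite map_cons inE negb_or => /andP[x0x x0l].
rewrite cons_uniq => /andP[xl ul].
rewrite -IHl; last by rewrite map_cons cons_uniq x0l ul.
rewrite expnS mulnA; congr (_ * _).
rewrite !card_sum_pred big_distrl /=.
under eq_bigr do rewrite mulnC -card_hval -sum_nat_const.
rewrite -(big_shift _ p (x p)); apply: eq_bigr => T _ /=.
transitivity (\sum_v all (fun y => tab_hash T y == tab_hash T x0) l *
                       (v == hxor (tab_hash T x0) (tab_hash T x)))%N; last first.
  by rewrite -big_distrr (bigD1 (hxor (tab_hash T x0) (tab_hash T x))) //= eqxx
     big1 ?muln1 // => v /negbTE->.
apply: eq_bigr => v _; rewrite !tab_hash_shift eqxx (negbTE x0x) hxor_eq.
have -> : all (fun y => tab_hash (shift p (x p) v T) y == tab_hash T x0) l =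
          all (fun y => tab_hash T y == tab_hash T x0) l.
  apply: eq_in_all => y yl; rewrite tab_hash_shift; case: (y p =P x p) => // E.
  by case/negP: xl; apply/mapP; exists y.
by case: (_ == _); case: (all _ _).
Qed.

(** * Image size through collisions in a common coordinate *)

Lemma card_le_prod_coord Y : #|Y| <= \prod_(i < c) #|[set (x : key c s) i | x in Y]|.
Proof.
have -> : \prod_(i < c) #|[set (x : key c s) i | x in Y]|
   = #|[pred f : key c s | [forall i, f i \in [set (x : key c s) i | x in Y]]]|.
  have := @card_family 'I_c (fun=> 'I_s) (fun i => mem [set (x : key c s) i | x in Y]).
  by rewrite foldrE big_image /= => <-; apply: eq_card => f.
apply: subset_leq_card; apply/subsetP => x xY; rewrite inE.
by apply/forallP=> i; apply: imset_f.
Qed.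

Lemma card_le_pow_coord Y t :
  (forall i : 'I_c, #|[set (x : key c s) i | x in Y]| <= t) -> #|Y| <= t ^ c.
Proof.
move=> H; apply: (leq_trans (card_le_prod_coord Y)).
by rewrite -[c in t ^ c]card_ord -prod_nat_const; apply: leq_prod.
Qed.

(** If every coordinate took at most [t] values on [Y], there would be at most [t ^ c] keys. The
    keys are packed as a finite function so that a union bound can range over [ffun_on Y]. *)
Lemma many_coord Y t : t ^ c < #|Y| ->
  exists i : 'I_c, exists f : {ffun 'I_t.+1 -> key c s},
    f \in ffun_on Y /\ injective (fun j => f j i).
Proof.
move=> tY; have /existsP[i it] : [exists i : 'I_c, t < #|[set (x : key c s) i | x in Y]|].
  apply: contraTT tY; rewrite negb_exists -leqNgt => /forallP H.
  by apply: card_le_pow_coord => i; rewrite leqNgt H.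
exists i; set A := [set _ | _ in _] in it.
have F (j : 'I_t.+1) : exists x, (x \in Y) && (x i == enum_val (widen_ord it j)).
  have /imsetP[x xY ->] := enum_valP (widen_ord it j).
  by exists x; rewrite xY /=.
exists [ffun j => xchoose (F j)]; split.
  by apply/ffun_onP=> j; rewrite ffunE; case/andP: (xchooseP (F j)).
move=> j k; rewrite !ffunE.
have /andP[_ /eqP->] := xchooseP (F j); have /andP[_ /eqP->] := xchooseP (F k).
by move=> /enum_val_inj/(congr1 val) /= /ord_inj.
Qed.

Lemma card_le_load T Y d :
  (forall v, #|[set x in Y | tab_hash T x == v]| <= d) -> #|Y| <= d * #|himage T Y|.
Proof.
move=> H; rewrite -sum1_card (partition_big_imset (tab_hash T)) /= mulnC -sum_nat_const.
apply: leq_sum => v _; apply: leq_trans (H v).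
by rewrite -sum1dep_card leq_eqVlt; apply/orP; left; apply/eqP/eq_bigl=> x.
Qed.

(** A small image forces some load above [t ^ c], hence [t + 1] colliding keys that differ in one
    coordinate. The union bound runs over [c] coordinates and [#|Y| ^ t.+1] tuples, each of
    probability at most [(2 ^ r) ^ (- t)]. *)
Lemma card_high_load Y t :
  #|[set T : tables c s r | t ^ c * #|himage T Y| < #|Y|]| * (2 ^ r) ^ t
    <= c * #|Y| ^ t.+1 * #|{: tables c s r}|.
Proof.
pose coll (i : 'I_c) (f : {ffun 'I_t.+1 -> key c s}) :=
  [set T : tables c s r | injectiveb (fun j => f j i) &&
     all (fun j => tab_hash T (f j) == tab_hash T (f ord0)) (enum 'I_t.+1)].
have coll_le i f : #|coll i f| * (2 ^ r) ^ t <= #|{: tables c s r}|.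
  rewrite /coll; case: (boolP (injectiveb _)) => [/injectiveP inj|_]; last first.
    by rewrite (_ : [set _ | _] = set0) ?cards0 //; apply/setP=> T; rewrite !inE.
  set l := [seq f (lift ord0 j) | j <- enum 'I_t].
  have sl : size l = t by rewrite size_map size_enum_ord.
  rewrite -[in (2 ^ r) ^ t]sl -(@card_collision i (f ord0) l); last first.
    have -> : f ord0 :: l = [seq f j | j <- enum 'I_t.+1].
      by rewrite enum_ordSl /= -map_comp.
    by rewrite -map_comp map_inj_uniq ?enum_uniq.
  rewrite leq_mul2r; apply/orP; right; apply: subset_leq_card.
  apply/subsetP=> T; rewrite !inE enum_ordSl /= => /andP[_]; rewrite /l !all_map.
  exact.
have sub : [set T : tables c s r | t ^ c * #|himage T Y| < #|Y|] \subset
    \bigcup_(i < c) \bigcup_(f in ffun_on Y) coll i f.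
  apply/subsetP=> T; rewrite inE => lt.
  have /existsP[v] : [exists v, t ^ c < #|[set x in Y | tab_hash T x == v]|].
    apply: contraTT lt; rewrite negb_exists -leqNgt => /forallP H.
    by apply: card_le_load => v; rewrite leqNgt H.
  move/many_coord => [i [f [/ffun_onP fY inj]]].
  have fv j : tab_hash T (f j) = v by have := fY j; rewrite inE => /andP[_ /eqP].
  apply/bigcupP; exists i => //; apply/bigcupP; exists f.
    by apply/ffun_onP=> j; have := fY j; rewrite inE => /andP[].
  rewrite inE; apply/andP; split; first exact/injectiveP.
  by apply/allP=> j _; rewrite !fv.
apply: (@leq_trans ((\sum_(i < c) \sum_(f in ffun_on Y) #|coll i f|) * (2 ^ r) ^ t)).
  rewrite leq_mul2r; apply/orP; right; apply: (leq_trans (subset_leq_card sub)).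
  apply: (leq_trans (leq_card_bigcup _ _)); apply: leq_sum => i _.
  exact: leq_card_bigcup.
have -> : c * #|Y| ^ t.+1 * #|{: tables c s r}| =
          \sum_(i < c) \sum_(f : {ffun 'I_t.+1 -> key c s} | f \in ffun_on (mem Y)) #|{: tables c s r}|.
  by rewrite !sum_nat_const card_ffun_on !card_ord mulnA.
rewrite big_distrl; apply: leq_sum => i _; rewrite big_distrl.
by apply: leq_sum => f _; apply: coll_le.
Qed.

(** * Fibers of a coordinate and light characters *)

Definition fiber (X : {set key c s}) p a := [set x in X | x p == a].

Lemma sum_card_fiber X p : \sum_a #|fiber X p a| = #|X|.
Proof.
rewrite -[RHS]sum1_card (partition_big (fun x : key c s => x p) xpredT) //=.
by apply: eq_bigr => a _; rewrite -sum1dep_card; apply: eq_bigl.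
Qed.

(* A key with no light character has one of at most [N] heavy characters in each
   coordinate, so there are at most [N ^ c] such keys. *)
Lemma light_coordinate X B N : 0 < B -> #|X| <= N * B -> 2 * N ^ c <= #|X| ->
  exists p X', [/\ X' \subset X, #|X| <= 2 * c * #|X'| &
    forall a, #|fiber X' p a| <= B].
Proof.
move=> B0 XNB NX.
pose L p := [set x in X | #|fiber X p (x p)| <= B].
pose H := [set x in X | [forall p : 'I_c, B < #|fiber X p (x p)|]].
have HN : #|H| <= N ^ c.
  apply: card_le_pow_coord => p; rewrite -(leq_pmul2r B0); apply: leq_trans XNB.
  rewrite -(sum_card_fiber X p) -sum_nat_const [leqRHS](bigID (mem [set (x : key c s) p | x in H])) /=.
  apply: leq_trans (leq_addr _ _); apply: leq_sum => a /imsetP[x].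
  by rewrite inE => /andP[_ /forallP/(_ p)/ltnW] ? ->.
have XH : X \subset H :|: \bigcup_p L p.
  apply/subsetP=> x xX; rewrite inE; case: (boolP (x \in H)) => //=.
  rewrite inE xX negb_forall => /existsP[p]; rewrite -leqNgt => xp.
  by apply/bigcupP; exists p => //; rewrite inE xX.
have : #|X| <= 2 * \sum_p #|L p|.
  have := leq_trans (subset_leq_card XH) (leq_card_setU _ _).1.
  have := leq_card_bigcup xpredT L; lia.
(* For [c = 0] the sum is empty, which contradicts [2 * N ^ 0 <= #|X|]. *)
have [c0|c0] := posnP c.
  rewrite big1 => [|[p ?]]; last by exfalso; lia.
  by have e : N ^ c = 1 by [rewrite c0]; lia.
pose p0 := Ordinal c0; pose p := [arg max_(i > p0) #|L i|].
have Lp i : #|L i| <= #|L p| by rewrite /p; case: arg_maxnP => // j _; apply.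
have : \sum_i #|L i| <= c * #|L p|.
  have -> : c * #|L p| = \sum_(i < c) #|L p| by rewrite sum_nat_const card_ord.
  exact: leq_sum.
move=> h1 h2; exists p, (L p); split; first by apply/subsetP=> x; rewrite inE => /andP[].
  by apply: (leq_trans h2); rewrite -mulnA leq_mul2l h1 orbT.
(* One light key in the fiber suffices: the whole fiber of [X] through it has size at most [B]. *)
move=> a; case: (set_0Vmem (fiber (L p) p a)) => [->|[x]]; first by rewrite cards0.
rewrite !inE => /andP[/andP[xX fx] /eqP xa]; apply: leq_trans fx; rewrite xa.
by apply: subset_leq_card; apply/subsetP=> y; rewrite !inE => /andP[/andP[-> _] ->].
Qed.

End Shift.

(** * A power inequality and probabilities of table events *)

Local Open Scope ring_scope.

(** While [q * u <= 1], halving the linear term absorbs the second-order error. The case [q = 1]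
    serves plain expectations, where [u] may be as large as 1. *)
Lemma expr_onem_le (R : realFieldType) (u : R) (q : nat) :
  0 <= u <= 1 -> q%:R * u <= 1 \/ q = 1%N -> (1 - u) ^+ q <= 1 - q%:R * u / 2.
Proof.
move=> /andP[u0 u1] [qu|->]; last by rewrite expr1; lra.
elim: q qu => [|q IHq] qu; first by rewrite expr0; lra.
have {}IHq : (1 - u) ^+ q <= 1 - q%:R * u / 2.
  by apply: IHq; apply: le_trans qu; rewrite ler_wpM2r // ler_nat.
rewrite exprSr; apply: (le_trans (ler_wpM2r _ IHq)); first by rewrite subr_ge0.
rewrite -natr1 in qu *.
have : q%:R * u * u <= 1 * u by rewrite ler_wpM2r //; lra.
lra.
Qed.

Section Prob.
Variables (R : realType) (c s r : nat).
Implicit Types (E F G : pred (tables c s r)).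

Lemma card_tables_gt0 : 0 < #|{: tables c s r}|%:R :> R.
Proof. by rewrite ltr0n; apply/card_gt0P; exists [ffun=> [ffun=> hzero r]]. Qed.

Lemma tprob_le1 E : tprob R E <= 1.
Proof.
by rewrite /tprob ler_pdivrMr ?card_tables_gt0 // mul1r ler_nat max_card.
Qed.

Lemma tprob_leU E F G : (forall T, E T -> F T \/ G T) -> tprob R E <= tprob R F + tprob R G.
Proof.
move=> EFG; rewrite /tprob -mulrDl ler_pM2r ?invr_gt0 ?card_tables_gt0 //.
rewrite -natrD ler_nat; apply: leq_trans (leq_card_setU _ _).1.
by apply/subset_leq_card/subsetP=> T; rewrite !inE => /EFG/orP.
Qed.

Lemma tprob0 E : (forall T, ~ E T) -> tprob R E = 0.
Proof.
move=> E0; rewrite /tprob (_ : [set _ | _] = set0) ?cards0 ?mul0r //.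
by apply/setP=> T; rewrite !inE; apply/negP/E0.
Qed.

Lemma tprob_le E F : (forall T, E T -> F T) -> tprob R E <= tprob R F.
Proof.
move=> EF; rewrite -[leRHS]addr0 -(@tprob0 pred0) //.
by apply: tprob_leU => T /EF; left.
Qed.

Lemma tprob_high_load (Y : {set key c s}) t :
  tprob R (fun T : tables c s r => (t ^ c * #|himage T Y| < #|Y|)%N) <=
  c%:R * #|Y|%:R ^+ t.+1 / (2 ^ r)%:R ^+ t.
Proof.
have n0 : 0 < (2 ^ r)%:R ^+ t :> R by rewrite exprn_gt0 // ltr0n expn_gt0.
rewrite /tprob ler_pdivrMr ?card_tables_gt0 // mulrAC ler_pdivlMr //.
by rewrite -!natrX -!natrM ler_nat card_high_load.
Qed.

(** * The potential of the empty bins *)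

Section Potential.
Variables (p : 'I_c) (X : {set key c s}) (d B : nat).
Hypothesis fiberB : forall a, (#|fiber X p a| <= B)%N.
Implicit Types (T : tables c s r) (l : seq 'I_s).

Definition spread T := [forall a, #|fiber X p a| <= d * #|himage T (fiber X p a)|]%N.

(** [l] lists the characters revealed so far. *)
Definition uncovered l T := ~: \bigcup_(a <- l) himage T (fiber X p a).

(** A union bound over the fibers, with [#|fiber| ^ t.+1 <= #|fiber| * B ^ t], so that the fiber
    sizes add up to [#|X|]. *)
Lemma tprob_not_spread t : d = (t ^ c)%N ->
  tprob R (fun T => ~~ spread T) <= c%:R * #|X|%:R * B%:R ^+ t / (2 ^ r)%:R ^+ t.
Proof.
move=> dt; have n0 : 0 < (2 ^ r)%:R ^+ t :> R by rewrite exprn_gt0 // ltr0n expn_gt0.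
rewrite /tprob ler_pdivrMr ?card_tables_gt0 // mulrAC ler_pdivlMr //.
rewrite -!natrX -!natrM ler_nat.
pose bad a := [set T : tables c s r | d * #|himage T (fiber X p a)| < #|fiber X p a|]%N.
have sub : [set T | ~~ spread T] \subset \bigcup_a bad a.
  apply/subsetP=> T; rewrite inE negb_forall => /existsP[a].
  by rewrite -ltnNge => Ta; apply/bigcupP; exists a; rewrite ?inE.
apply: (@leq_trans ((\sum_a #|bad a|) * (2 ^ r) ^ t)).
  by rewrite leq_mul2r (leq_trans (subset_leq_card sub)) ?leq_card_bigcup ?orbT.
rewrite -(sum_card_fiber X p) big_distrl big_distrr /= !big_distrl /=.
apply: leq_sum => a _; rewrite /bad dt; apply: (leq_trans (card_high_load _ _ _)).
rewrite leq_mul2r; apply/orP; right; rewrite -mulnA leq_mul2l; apply/orP; right.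
by rewrite expnS leq_mul2l; apply/orP; right; case: (t) => [//|t0]; rewrite leq_exp2r ?fiberB.
Qed.

Lemma himage_fiber_shift_in a v T :
  himage (shift p a v T) (fiber X p a) = [set hxor w v | w in himage T (fiber X p a)].
Proof. by apply: himage_shift_in => x; rewrite inE => /andP[_ /eqP]. Qed.

Lemma himage_fiber_shift_notin a b v T : b != a ->
  himage (shift p a v T) (fiber X p b) = himage T (fiber X p b).
Proof. by move=> ba; apply: himage_shift_notin => x; rewrite inE => /andP[_ /eqP->]. Qed.

(** Translation preserves image sizes, so restricting to spread tables is compatible with
    re-randomization. *)
Lemma spread_shift a v T : spread (shift p a v T) = spread T.
Proof.
apply: eq_forallb => b; case: (eqVneq b a) => [->|ba].
  by rewrite himage_fiber_shift_in card_imset //; apply: hxor_injr.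
by rewrite himage_fiber_shift_notin.
Qed.

Lemma uncovered_shift a v l T : a \notin l -> uncovered l (shift p a v T) = uncovered l T.
Proof.
move=> al; rewrite /uncovered; congr (~: _); rewrite !big_seq; apply: eq_bigr => b bl.
by rewrite himage_fiber_shift_notin //; apply: contraNneq al => <-.
Qed.

(** Double counting: for each [w] in [S], [hxor w v] meets every value once as [v] varies. *)
Lemma sum_card_translate (E S : {set hval r}) :
  (\sum_v #|E :&: [set hxor w v | w in S]| = #|E| * #|S|)%N.
Proof.
have E1 v : (#|E :&: [set hxor w v | w in S]| = \sum_(w in S) (hxor w v \in E))%N.
  rewrite -sum1_card (eq_bigl (fun w => (w \in [set hxor w v | w in S]) && (w \in E))); last first.
    by move=> w; rewrite inE andbC.
  rewrite big_mkcondr big_imset /=; last by move=> ? ? _ _; apply: hxor_injr.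
  by apply: eq_bigr => w _; case: (_ \in _).
under eq_bigr do rewrite E1.
rewrite exchange_big /= mulnC -sum_nat_const; apply: eq_bigr => w _.
rewrite -sum1_card [RHS]big_mkcond (reindex_inj (@hxor_injr r w)) /=.
by apply: eq_bigr => v _; rewrite hxorC hxorK; case: (_ \in _).
Qed.

Variables (q L : nat).
Hypothesis qBL : (q * B <= L)%N \/ q = 1%N.
Hypothesis d0 : (0 < d)%N.
Let n : R := (2 ^ r)%:R.

(** The cutoff at [L >= q * B] keeps the fraction of empty bins filled by one fiber below [1 / q],
    as the power inequality requires; for [q = 1] any [L] will do. *)
Definition potential l T : R :=
  if spread T && (L < #|uncovered l T|)%N then #|uncovered l T|%:R ^+ q else 0.

Lemma potential_ge0 l T : 0 <= potential l T.
Proof. by rewrite /potential; case: ifP => // _; rewrite exprn_ge0. Qed.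

(** A fresh translate of the image [S] of the new fiber fills on average [#|E| * #|S| / n] of the
    empty bins [E], and spreadness gives [#|S| >= #|fiber| / d]. *)
Lemma sum_potential_shift a l T : a \notin l ->
  \sum_v potential (a :: l) (shift p a v T) <=
  n * expR (- (q%:R * #|fiber X p a|%:R / (2 * d%:R * n))) * potential l T.
Proof.
move=> al; set S := himage T (fiber X p a); set E := uncovered l T.
have n0 : 0 < n by rewrite ltr0n expn_gt0.
have EE v : uncovered (a :: l) (shift p a v T) = E :\: [set hxor w v | w in S].
  rewrite /uncovered big_cons setCU -/(uncovered _ _) uncovered_shift // setIC.
  by rewrite himage_fiber_shift_in -setDE.
(* A vanished potential stays zero: spreadness is invariant and the set of empty bins only
   shrinks. *)
rewrite {2}/potential -/E; case: ifP => [/andP[sp LE]|H]; last first.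
  rewrite mulr0 big1 // => v _; rewrite /potential spread_shift EE; case: ifP => //.
  move=> /andP[sp lt]; move: H; rewrite sp /= (leq_trans lt) //.
  by rewrite subset_leq_card ?subsetDl.
have E0 : 0 < #|E|%:R :> R by rewrite ltr0n (leq_ltn_trans _ LE).
pose D v := #|E :&: [set hxor w v | w in S]|.
have SB : (#|S| <= B)%N by apply: leq_trans (leq_imset_card _ _) (fiberB a).
have pot_le v : potential (a :: l) (shift p a v T) <=
    #|E|%:R ^+ q * (1 - q%:R * ((D v)%:R / #|E|%:R) / 2).
  have DE : (D v <= #|E|)%N by rewrite subset_leq_card ?subsetIl.
  have DS : (D v <= #|S|)%N.
    apply: (leq_trans (subset_leq_card (subsetIr _ _))).
    exact: leq_imset_card.
  apply: (@le_trans _ _ (#|E|%:R ^+ q * (1 - (D v)%:R / #|E|%:R) ^+ q)).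
    rewrite -exprMn mulrBr mulr1 mulrCA divff ?lt0r_neq0 // mulr1.
    rewrite -natrB // /potential EE -cardsD; case: ifP => // _.
    by rewrite exprn_ge0.
  rewrite ler_wpM2l ?exprn_ge0 //; apply: expr_onem_le.
    by rewrite divr_ge0 //= ler_pdivrMr // mul1r ler_nat.
  case: qBL => [qB|->]; [left|by right].
  rewrite mulrA ler_pdivrMr // mul1r -natrM ler_nat.
  apply: leq_trans (ltnW LE); apply: leq_trans qB.
  by rewrite leq_mul2l (leq_trans DS SB) orbT.
apply: (le_trans (ler_sum _ (fun v _ => pot_le v))).
rewrite -mulr_sumr mulrC ler_wpM2r ?exprn_ge0 //.
rewrite sumrB sumr_const card_hval -/n.
have -> : \sum_v q%:R * ((D v)%:R / #|E|%:R) / 2 = q%:R * #|S|%:R / 2 :> R.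
  rewrite -!mulr_suml -mulr_sumr -mulr_suml -natr_sum sum_card_translate natrM.
  by rewrite [_ * #|S|%:R]mulrC mulfK ?lt0r_neq0.
have dS : #|fiber X p a|%:R <= d%:R * #|S|%:R :> R.
  by rewrite -natrM ler_nat; move/forallP: sp => /(_ a).
apply: le_trans (ler_wpM2l (ltW n0) (expR_ge1Dx _)).
rewrite mulrDr mulr1 lerD2l mulrN lerN2.
have d0' : 0 < d%:R :> R by rewrite ltr0n.
have -> : n * (q%:R * #|fiber X p a|%:R / (2 * d%:R * n)) =
   q%:R * (#|fiber X p a|%:R / d%:R) / 2.
  by field; rewrite !lt0r_neq0.
rewrite ler_pM2r ?invr_gt0 // ler_wpM2l // ler_pdivrMr //.
by rewrite mulrC.
Qed.

Lemma sum_potential l : uniq l ->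
  \sum_T potential l T <=
  #|{: tables c s r}|%:R * n ^+ q *
  expR (- (q%:R * (\sum_(a <- l) #|fiber X p a|)%:R / (2 * d%:R * n))).
Proof.
have n0 : 0 < n by rewrite ltr0n expn_gt0.
elim: l => [_|a l IHl /andP[al ul]].
  rewrite big_nil mulr0 mul0r oppr0 expR0 mulr1 mulr_natl -sumr_const.
  apply: ler_sum => T _; rewrite /potential; case: ifP => _; last by rewrite exprn_ge0 ?ltW.
  by apply: lerXn2r; rewrite ?nnegrE ?ler0n // /n -card_hval ler_nat max_card.
rewrite -(ler_pM2l n0) big_cons natrD mulrDr mulrDl opprD expRD.
(* The factor [n] becomes a dummy sum over [v], which [big_shift] turns into a re-randomization of
   the entry at [a]. *)
have -> : n * (\sum_T potential (a :: l) T) = \sum_T \sum_(v : hval r) potential (a :: l) T.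
  rewrite mulr_sumr; apply: eq_bigr => T _.
  by rewrite sumr_const card_hval mulr_natl.
rewrite -(big_shift _ p a).
apply: (le_trans (ler_sum _ (fun T _ => sum_potential_shift T al))).
rewrite -mulr_sumr -[leLHS]mulrA ler_pM2l //.
rewrite [leRHS]mulrCA ler_pM2l ?expR_gt0 //; exact: IHl.
Qed.

Lemma uncovered_enum T : uncovered (enum 'I_s) T = ~: himage T X.
Proof.
rewrite /uncovered; congr (~: _); apply/setP=> v; apply/idP/imsetP.
  rewrite big_enum /= => /bigcupP[a _ /imsetP[x]]; rewrite inE => /andP[xX _] ->.
  by exists x.
move=> [x xX ->]; rewrite big_enum; apply/bigcupP; exists (x p) => //.
by apply: imset_f; rewrite inE xX /=.
Qed.

(** Markov's inequality for the potential after all characters are revealed. *)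
Lemma tprob_uncovered (theta : R) : 0 < theta ->
  tprob R (fun T => [&& spread T, (L < #|~: himage T X|)%N & theta <= #|~: himage T X|%:R]) <=
  (n / theta) ^+ q * expR (- (q%:R * #|X|%:R / (2 * d%:R * n))).
Proof.
move=> th0; rewrite /tprob ler_pdivrMr ?card_tables_gt0 //.
have := sum_potential (enum_uniq 'I_s); rewrite big_enum /= sum_card_fiber.
set e := expR _; set t := #|{: tables c s r}|%:R => H.
have -> : (n / theta) ^+ q * e * t = t * n ^+ q * e / theta ^+ q by rewrite expr_div_n; ring.
rewrite ler_pdivlMr ?exprn_gt0 //.
apply: le_trans H; rewrite card_sum_pred natr_sum mulr_suml; apply: ler_sum => T _.
case: and3P => [[sp LE tE]|_]; last by rewrite mul0r potential_ge0.
rewrite mul1r /potential uncovered_enum sp LE /= lerXn2r ?nnegrE //; exact: ltW.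
Qed.

End Potential.
End Prob.

(** * Exponential estimates *)

(** Follows from [(1 - 1/x) * (1 + 2/x) >= 1], valid for [x >= 2]. *)
Lemma expR_le_onem_inv (R : realType) (x : R) : 2 <= x -> expR (- (2 / x)) <= 1 - x^-1.
Proof.
move=> x2; have x0 : 0 < x by lra.
have e0 := expR_gt0 (2 / x); rewrite expRN -[_^-1]mul1r ler_pdivrMr //.
have u0 : 0 < x^-1 by rewrite invr_gt0.
have xu : x * x^-1 = 1 by rewrite divff ?lt0r_neq0.
apply: (@le_trans _ _ ((1 - x^-1) * (1 + 2 / x))); first by nra.
by apply: ler_wpM2l (expR_ge1Dx _); nra.
Qed.

Lemma expR_le_powR_onem (R : realType) (x a : R) : 2 <= x -> 0 <= a ->
  expR (- (2 * a / x)) <= (1 - x^-1) `^ a.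
Proof.
move=> x2 a0; have -> : - (2 * a / x) = - (2 / x) * a by ring.
have h := expR_le_onem_inv x2; rewrite expRM ge0_ler_powR // nnegrE ?expR_ge0 //.
exact: le_trans (expR_ge0 _) h.
Qed.

(** Uses [exp y >= y] at [y = x / (A * g)], raised to the power [g]. *)
Lemma expRN_le_invX (R : realType) (x A : R) (g : nat) : 0 < x -> 0 < A -> (0 < g)%N ->
  expR (- (x / A)) <= (A * g%:R) ^+ g / x ^+ g.
Proof.
move=> x0 A0 g0; have g0' : 0 < g%:R :> R by rewrite ltr0n.
have -> : x / A = g%:R * (x / (A * g%:R)) by field; rewrite !lt0r_neq0.
rewrite expRN expRM_natl -expr_div_n -exprVn.
have h : 0 < x / (A * g%:R) by rewrite divr_gt0 ?mulr_gt0.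
apply: lerXn2r; rewrite ?nnegrE ?invr_ge0 ?expR_ge0 ?divr_ge0 ?mulr_ge0 ?(ltW A0) ?(ltW x0) //.
rewrite -[leRHS]invf_div lef_pV2 ?posrE ?expR_gt0 //.
by apply: le_trans (expR_ge1Dx _); rewrite lerDr.
Qed.

Lemma exists_subset_card (T : finType) (A : {set T}) m : (m <= #|A|)%N ->
  exists2 B : {set T}, B \subset A & #|B| = m.
Proof.
case/card_geqP => l [ul <- lA]; exists [set x in l].
  by apply/subsetP=> x; rewrite inE => /lA.
by rewrite cardsE; apply/card_uniqP.
Qed.

Lemma sqr_le_pow2 m : (4 <= m)%N -> (m * m <= 2 ^ m)%N.
Proof.
elim: m => // m IHm; rewrite leq_eqVlt => /orP[/eqP <- //|m4].
by have := IHm m4; rewrite expnS; nia.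
Qed.

(** * Scales and numeric bounds *)

Section Regimes.
Variables (R : realType) (c s r g : nat).
Hypotheses (c_gt0 : (0 < c)%N) (g_gt0 : (0 < g)%N).

(* [z] is about [n ^ (1 / D)] and is the unit in which every polynomial gap is
   measured: [B = n / z ^ 3] bounds the fibers, and the failure probabilities are
   [O(z ^ (- g))]. The range [|X| <= M k n] is the [m = O(n log n)] one, and
   [4 M] is the final [beta]. *)
Local Notation D := (4 * c + 2)%N.
Local Notation t := (D + 1 + g)%N.
Local Notation d := (t ^ c)%N.
Local Notation M := (4 * c * d * (D + g))%N.
Local Notation k := (r %/ D)%N.
Local Notation z := (2 ^ k)%N.
Local Notation n := (2 ^ r)%N.
Local Notation B := (2 ^ (r - 3 * k))%N.

Lemma scale_pow_le : (z ^ D <= n)%N.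
Proof. by rewrite -expnM leq_pexp2l // leq_divM. Qed.

(** Rounding [r / D] down loses at most the constant [2 ^ D]. *)
Lemma le_scale_pow : (n <= 2 ^ D * z ^ D)%N.
Proof.
rewrite -expnM -expnD leq_pexp2l //; have := @ltn_ceil r D.
rewrite mulSn; lia.
Qed.

(** Since [3 <= D], the subtraction in [B] is not truncated. *)
Lemma fiber_bound_mul : (B * z ^ 3)%N = n.
Proof.
rewrite -expnM -expnD; congr (2 ^ _)%N; have := leq_divM r D; nia.
Qed.

(** Here [m ^ t.+1 / n ^ t <= n / z ^ t]; in [t = D + 1 + g], the part [D] pays for [n] and [g]
    remains. *)
Lemma small_load_le m : (m * z <= n)%N -> (m ^ t.+1 * z ^ g <= 2 ^ D * n ^ t)%N.
Proof.
move=> mz; have z0 : (0 < z ^ (D + 1))%N by rewrite !expn_gt0.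
rewrite -(leq_pmul2r z0).
have -> : (m ^ t.+1 * z ^ g * z ^ (D + 1) = m * (m * z) ^ t)%N.
  by rewrite -mulnA -expnD [(g + _)%N]addnC expnMn expnS mulnA.
have mn : (m <= n)%N by apply: leq_trans mz; rewrite leq_pmulr // expn_gt0.
apply: (@leq_trans (n * n ^ t)); first by rewrite leq_mul // leq_exp2r // addn1.
rewrite mulnAC leq_mul2r (leq_trans le_scale_pow) ?orbT //.
by rewrite leq_mul2l leq_pexp2l ?expn_gt0 ?leq_addr ?orbT.
Qed.

Lemma fiber_load_le m : (m <= n * z)%N -> (m * B ^ t * z ^ g <= 2 ^ D * n ^ t)%N.
Proof.
move=> mz; rewrite -fiber_bound_mul expnMn -(expnM z 3 t).
have h : (m <= 2 ^ D * z ^ (D + 1))%N.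
  apply: (leq_trans mz); rewrite [(z ^ (D + 1))%N]expnD expn1 mulnA leq_mul2r.
  by rewrite le_scale_pow orbT.
apply: (@leq_trans (2 ^ D * z ^ (D + 1) * B ^ t * z ^ g)).
  by rewrite !leq_mul2r h !orbT.
have -> : (2 ^ D * z ^ (D + 1) * B ^ t * z ^ g = 2 ^ D * (B ^ t * z ^ t))%N.
  by rewrite [(z ^ t)%N]expnD mulnA [in RHS]mulnA [(_ * B ^ t)%N in LHS]mulnAC.
by rewrite !leq_mul2l leq_pexp2l ?expn_gt0 ?orbT //; lia.
Qed.

Implicit Types (X : {set key c s}) (T : tables c s r).

Lemma exists_light_subset X : (1 < z)%N -> (n < #|X| * z)%N -> (#|X| <= n * z)%N ->
  exists p X', [/\ X' \subset X, (#|X| <= 2 * c * #|X'|)%N,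
    (forall a, #|fiber X' p a| <= B)%N &
    tprob R (fun T => ~~ spread p X' d T) <= (c * 2 ^ D)%:R / z%:R ^+ g].
Proof.
move=> z1 nX Xn; have B0 : (0 < B)%N by rewrite expn_gt0.
(* With [N = z ^ 4], [N * B = n * z]. The choice [D = 4 * c + 2] gives
   [2 * N ^ c <= z ^ (D - 1) <= n / z < #|X|]. *)
have [||p [X' [sX cX fB]]] := light_coordinate (N := z ^ 4) B0 (X := X).
- by rewrite mulnC -[4%N]/(3 + 1)%N expnD expn1 mulnA fiber_bound_mul.
- have z0 : (0 < z)%N by exact: ltnW.
  rewrite -(leq_pmul2r z0); apply: leq_trans (ltnW nX).
  apply: leq_trans scale_pow_le; rewrite -(expnM z 4 c) -mulnA -(expnSr z).
  have -> : (z ^ D = z * z ^ (4 * c).+1)%N by rewrite -expnS addn2.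
  by rewrite leq_mul2r z1 orbT.
exists p, X'; split=> //.
apply: le_trans (tprob_not_spread R r fB (erefl d)) _.
have z0 : 0 < z%:R ^+ g :> R by rewrite exprn_gt0 // ltr0n expn_gt0.
have n0 : 0 < n%:R ^+ t :> R by rewrite exprn_gt0 // ltr0n expn_gt0.
rewrite ler_pdivrMr // [leRHS]mulrAC ler_pdivlMr // -!natrX -!natrM ler_nat.
rewrite -!mulnA leq_mul2l; apply/orP; right; rewrite !mulnA; apply: fiber_load_le.
by apply: leq_trans Xn; apply: subset_leq_card.
Qed.

(** * The three ranges of the number of keys *)

Definition few_hit X T :=
  #|himage T X|%:R < n%:R * (1 - (1 - n%:R^-1) `^ (#|X|%:R / (4 * M)%:R)) :> R.

Lemma n_ge2 : (1 < z)%N -> 2 <= n%:R :> R.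
Proof.
move=> z1; rewrite ler_nat; apply: leq_trans scale_pow_le.
apply: (leq_trans z1); have : (z ^ 1 <= z ^ D)%N; last by rewrite expn1.
by rewrite leq_pexp2l ?expn_gt0 // addn2.
Qed.

Lemma d_gt0 : (0 < d)%N.
Proof. by rewrite expn_gt0; apply/orP; left; lia. Qed.

Lemma M_ge : (4 * c * d <= M)%N.
Proof. by rewrite leq_pmulr //; lia. Qed.

Lemma M_gt0 : (0 < M)%N.
Proof. by rewrite !muln_gt0 c_gt0 d_gt0 addn_gt0 g_gt0 orbT. Qed.

(** As [n * (1 - (1 - 1/n) ^ a) <= 2 * a], few hits force [#|h(X)| < #|X| / (2 * M) <= #|X| / d], a
    high-load event. *)
Lemma tprob_few_hit_small X : (1 < z)%N -> (#|X| * z <= n)%N ->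
  tprob R (few_hit X) <= (c * 2 ^ D)%:R / z%:R ^+ g.
Proof.
move=> z1 Xz; have n2 := n_ge2 z1.
have d0 : 0 < d%:R :> R by rewrite ltr0n d_gt0.
have M0 : 0 < (4 * M)%:R :> R by rewrite ltr0n muln_gt0 M_gt0.
apply: (@le_trans _ _ (tprob R (fun T : tables c s r => (d * #|himage T X| < #|X|)%N))).
  apply: tprob_le => T; rewrite /few_hit -(ltr_nat R) => lt.
  set a : R := #|X|%:R / (4 * M)%:R in lt.
  have a0 : 0 <= a by rewrite divr_ge0 // ltW.
  have h1 := expR_le_powR_onem n2 a0.
  have h2 := expR_ge1Dx (- (2 * a / n%:R)).
  have n0 : 0 < n%:R :> R by lra.
  have h3 : #|himage T X|%:R < 2 * a.
    apply: (lt_le_trans lt); apply: (@le_trans _ _ (n%:R * (2 * a / n%:R))).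
      by rewrite ler_pM2l // lerBlDr -lerBlDl (le_trans h2 h1).
    by rewrite mulrCA divff ?mulr1 // lt0r_neq0.
  rewrite natrM mulrC -ltr_pdivlMr //; apply: (lt_le_trans h3).
  rewrite /a mulrA ler_pdivrMr // mulrAC ler_pdivlMr //.
  rewrite -mulrA mulrCA ler_wpM2l // -natrM ler_nat.
  rewrite (leq_trans _ (leq_mul (leqnn 4) M_ge)) // !mulnA.
  by rewrite leq_mul2r -[2%N]/(2 * 1)%N leq_mul ?orbT //; lia.
apply: le_trans (tprob_high_load R r X t) _.
have z0 : 0 < z%:R ^+ g :> R by rewrite exprn_gt0 // ltr0n expn_gt0.
have n0 : 0 < n%:R ^+ t :> R by rewrite exprn_gt0 // ltr0n expn_gt0.
rewrite ler_pdivrMr // [leRHS]mulrAC ler_pdivlMr // -!natrX -!natrM ler_nat.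
by rewrite -!mulnA leq_mul2l small_load_le ?orbT.
Qed.

Lemma card_uncovered_ge X X' T : X' \subset X ->
  n%:R - #|himage T X|%:R <= #|~: himage T X'|%:R :> R.
Proof.
move=> sX; rewrite lerBlDr -natrD ler_nat -card_hval -(cardsC (himage T X')) addnC leq_add2l.
by apply/subset_leq_card/imsetS.
Qed.

(** Few hits leave more than [n * exp (- #|X| / (2 * M * n))] empty bins. As [#|X| <= M * k * n],
    this is at least [n * exp (- k / 2) >= n / z = B * z ^ 2], so the potential with [q = z ^ 2] has
    not been cut off. *)
Lemma tprob_few_hit_medium X : (1 < z)%N -> (n < #|X| * z)%N -> (#|X| <= n * z)%N ->
  (#|X| <= M * k * n)%N ->
  tprob R (few_hit X) <= (c * 2 ^ D + (8 * c * d * g) ^ g)%:R / z%:R ^+ g.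
Proof.
move=> z1 nX Xn XM; have n2 := n_ge2 z1.
have [p [X' [sX cX fB sp]]] := exists_light_subset z1 nX Xn.
have n0 : 0 < n%:R :> R by lra.
have d0 : 0 < d%:R :> R by rewrite ltr0n d_gt0.
have c0 : 0 < c%:R :> R by rewrite ltr0n.
have z0 : 0 < z%:R :> R by rewrite ltr0n expn_gt0.
have M0 : 0 < M%:R :> R by rewrite ltr0n M_gt0.
(* The potential decays at least like [exp (- 2 * q * y)]; Markov at [theta] gives back
   [exp (q * y)], and [q * y >= z / (8 * c * d)]. *)
pose y : R := #|X|%:R / (8 * c%:R * d%:R * n%:R).
pose theta : R := n%:R * expR (- y).
have th0 : 0 < theta by rewrite mulr_gt0 ?expR_gt0.
rewrite natrD mulrDl; apply: le_trans (lerD sp (lexx _)).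
apply: le_trans (tprob_leU R (F := fun T => ~~ spread p X' d T)
  (G := fun T => [&& spread p X' d T, (B * z ^ 2 < #|~: himage T X'|)%N &
     theta <= #|~: himage T X'|%:R]) _) _.
  move=> T lt; case: (boolP (spread p X' d T)) => _; [right=> /=|by left].
  have := card_uncovered_ge T sX; move: lt; rewrite /few_hit.
  set w := _ `^ _; set u := #|~: _|%:R; set h := #|himage T X|%:R => lt le.
  have nw : n%:R * w < u by move: lt; rewrite mulrBr mulr1; lra.
  have hw : expR (- (2 * (#|X|%:R / (4 * M)%:R) / n%:R)) <= w.
    by apply: expR_le_powR_onem => //; rewrite divr_ge0.
  have e : 2 * (#|X|%:R / (4 * M)%:R) / n%:R = #|X|%:R / (2 * M%:R * n%:R) :> R.
    have F (x m v : R) : 0 < m -> 0 < v -> 2 * (x / (4 * m)) / v = x / (2 * m * v).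
      by move=> m0 v0; field; rewrite !lt0r_neq0.
    by rewrite (natrM _ 4) F.
  rewrite e in hw; apply/andP; split.
    rewrite -(ltr_nat R); apply: le_lt_trans nw.
    have -> : (B * z ^ 2)%:R = n%:R * z%:R^-1 :> R.
      have -> : n%:R = (B * z ^ 2)%:R * z%:R :> R.
        by rewrite -natrM -mulnA -(expnSr z 2) fiber_bound_mul.
      by rewrite mulfK // lt0r_neq0.
    rewrite ler_pM2l //; apply: le_trans hw.
    have -> : z%:R^-1 = (1 - 2^-1) ^+ k :> R.
      by rewrite natrX -exprVn; congr (_ ^+ _); lra.
    apply: (@le_trans _ _ (expR (- 2^-1) ^+ k)).
      by rewrite lerXn2r ?nnegrE ?expR_ge0 ?expR_ge1Dx //; lra.
    rewrite -expRM_natl ler_expR mulrN lerN2 ler_pdivrMr ?mulr_gt0 //.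
    have -> : k%:R / 2 * (2 * M%:R * n%:R) = (M * k * n)%:R :> R.
      have F (x m v : R) : x / 2 * (2 * m * v) = m * x * v by field.
      by rewrite F (natrM _ (M * k)) (natrM _ M).
    by rewrite ler_nat.
  apply: le_trans (ltW nw); rewrite ler_pM2l //; apply: le_trans hw.
  rewrite ler_expR lerN2 /y ler_wpM2l // lef_pV2 ?posrE ?mulr_gt0 //.
  rewrite ler_pM2r // -!natrM ler_nat.
  by rewrite (leq_trans _ (leq_mul (leqnn 2) M_ge)) // !mulnA.
apply: lerD => //.
apply: le_trans (tprob_uncovered r fB (q := z ^ 2) (L := B * z ^ 2) _ d_gt0 th0) _.
  by left; rewrite mulnC.
have -> : n%:R / theta = expR y.
  by rewrite /theta expRN invfM invrK mulrA divff ?mul1r // lt0r_neq0.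
rewrite -expRM_natl -expRD.
have A0 : 0 < 8 * c%:R * d%:R :> R by rewrite !mulr_gt0.
have -> : ((8 * c * d * g) ^ g)%:R = (8 * c%:R * d%:R * g%:R) ^+ g :> R.
  by rewrite natrX !natrM.
apply: le_trans (expRN_le_invX z0 A0 g_gt0).
have cX' : #|X|%:R / (4 * c%:R * d%:R * n%:R) <= #|X'|%:R / (2 * d%:R * n%:R) :> R.
  rewrite ler_pdivrMr ?mulr_gt0 //.
  have -> : #|X'|%:R / (2 * d%:R * n%:R) * (4 * c%:R * d%:R * n%:R) = (2 * c * #|X'|)%:R :> R.
    have F (x u v w : R) : 0 < u -> 0 < v -> 0 < w ->
        x / (2 * v * w) * (4 * u * v * w) = 2 * u * x.
      by move=> u0 v0 w0; field; rewrite !lt0r_neq0.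
    by rewrite F // !natrM.
  by rewrite ler_nat.
have yy : #|X|%:R / (4 * c%:R * d%:R * n%:R) = 2 * y.
  have F (x u v w : R) : 0 < u -> 0 < v -> 0 < w ->
      x / (4 * u * v * w) = 2 * (x / (8 * u * v * w)).
    by move=> u0 v0 w0; field; rewrite !lt0r_neq0.
  exact: F.
have zy : z%:R / (8 * c%:R * d%:R) <= (z ^ 2)%:R * y.
  rewrite ler_pdivrMr //.
  have -> : (z ^ 2)%:R * y * (8 * c%:R * d%:R) = z%:R * (#|X| * z)%:R / n%:R.
    have F (e x u v w : R) : 0 < u -> 0 < v -> 0 < w ->
        e ^+ 2 * (x / (8 * u * v * w)) * (8 * u * v) = e * (x * e) / w.
      by move=> u0 v0 w0; field; rewrite !lt0r_neq0.
    by rewrite (natrX _ z) /y F // natrM.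
  by rewrite ler_pdivlMr // ler_pM2l // ler_nat ltnW.
rewrite ler_expR -[(z ^ 2)%:R * _ / _]mulrA.
have : (z ^ 2)%:R * (2 * y) <= (z ^ 2)%:R * (#|X'|%:R / (2 * d%:R * n%:R)).
  by rewrite ler_wpM2l // -yy.
lra.
Qed.

Lemma tprob_few_hit_large X : (1 < z)%N -> (M * k <= z)%N -> (0 < k)%N ->
  (M * k * n <= #|X|)%N ->
  tprob R (few_hit X) <= (c * 2 ^ D + 2 ^ D)%:R / z%:R ^+ g.
Proof.
move=> z1 Mkz k0 XM; have n2 := n_ge2 z1.
have M0 := M_gt0.
have n0N : (0 < n)%N by rewrite expn_gt0.
(* Passing to exactly [M * k * n] keys keeps the size below [n * z], as the choice of a light
   coordinate demands. *)
have [X0 sX0 cX0] := exists_subset_card XM.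
have [||p [X' [sX cX fB sp]]] := @exists_light_subset X0 z1.
- rewrite cX0 mulnAC; apply: leq_trans (_ : 1 * z * n <= _)%N; first by rewrite mul1n ltn_Pmull.
  by rewrite !leq_mul // muln_gt0 M0.
- by rewrite cX0 mulnC leq_mul2l Mkz orbT.
have n0 : 0 < n%:R :> R by lra.
have d0 : 0 < d%:R :> R by rewrite ltr0n d_gt0.
have c0 : 0 < c%:R :> R by rewrite ltr0n.
have z0 : 0 < z%:R :> R by rewrite ltr0n expn_gt0.
rewrite natrD mulrDl; apply: le_trans (lerD sp (lexx _)).
apply: le_trans (tprob_leU R (F := fun T => ~~ spread p X' d T)
  (G := fun T => [&& spread p X' d T, (0 < #|~: himage T X'|)%N &
     1 <= #|~: himage T X'|%:R :> R]) _) _.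
  move=> T lt; case: (boolP (spread p X' d T)) => _; [right=> /=|by left].
  rewrite ler1n andbb -(ltr_nat R); apply: lt_le_trans (card_uncovered_ge T (subset_trans sX sX0)).
  rewrite subr_gt0; apply: (lt_le_trans lt).
  by rewrite mulrBr mulr1 gerBl mulr_ge0 ?powR_ge0.
apply: lerD => //.
apply: le_trans (tprob_uncovered r fB (q := 1) (L := 0) _ d_gt0 ltr01) _; first by right.
rewrite divr1 expr1 mul1r.
(* The factor [4 * c * d * (D + g)] of [M] is tuned here: the expected number of empty bins is at
   most [n * exp (- k * (D + g)) <= n / z ^ (D + g)]. *)
have e : (k * (D + g))%:R <= #|X'|%:R / (2 * d%:R * n%:R) :> R.
  rewrite ler_pdivlMr ?mulr_gt0 // -!natrM ler_nat.
  have c2 : (0 < 2 * c)%N by rewrite muln_gt0 c_gt0.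
  rewrite -(leq_pmul2l c2); apply: leq_trans cX; rewrite cX0.
  by apply: eq_leq; ring.
apply: (@le_trans _ _ (n%:R * (2^-1 ^+ (k * (D + g))))).
  rewrite ler_pM2l //; apply: (@le_trans _ _ (expR (- 1) ^+ (k * (D + g)))).
    by rewrite -expRM_natl mulrN1 ler_expR lerN2.
  rewrite lerXn2r ?nnegrE ?expR_ge0 ?invr_ge0 // expRN lef_pV2 ?posrE ?expR_gt0 //.
  by have := @expR_ge1Dx R 1; lra.
rewrite exprM exprVn -natrX exprVn exprD ler_pdivrMr ?mulr_gt0 ?exprn_gt0 //.
rewrite [z%:R ^+ D * _]mulrC mulrA divfK ?lt0r_neq0 ?exprn_gt0 //.
by rewrite -natrX -natrM ler_nat le_scale_pow.
Qed.

(** * Combining the ranges *)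

Local Notation K :=
  ((2 ^ (M + 4)) ^ g + (c * 2 ^ D + (8 * c * d * g) ^ g + 2 ^ D))%N.

Lemma tprob_few_hit X : tprob R (few_hit X) <= K%:R / z%:R ^+ g.
Proof.
have z0 : 0 < z%:R ^+ g :> R by rewrite exprn_gt0 // ltr0n expn_gt0.
have le_sum (w x y v : nat) : [/\ (x <= w + (x + y + v))%N,
    (x + y <= w + (x + y + v))%N & (x + v <= w + (x + y + v))%N].
  by clear; split; lia.
have weaken (b : nat) : tprob R (few_hit X) <= b%:R / z%:R ^+ g -> (b <= K)%N ->
    tprob R (few_hit X) <= K%:R / z%:R ^+ g.
  by move=> h bK; apply: (le_trans h); rewrite ler_pM2r ?invr_gt0 // ler_nat.
(* For small [k] the scale [z] is bounded and the claimed bound exceeds 1; otherwise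
   [M * k <= k * k <= 2 ^ k = z]. *)
have [km|mk] := ltnP k (M + 4).
  apply: (weaken ((2 ^ (M + 4)) ^ g)%N); last exact: leq_addr.
  apply: (le_trans (tprob_le1 _ _)); rewrite ler_pdivlMr // mul1r -natrX ler_nat.
  by rewrite leq_exp2r // leq_pexp2l // ltnW.
have k4 : (4 <= k)%N by apply: leq_trans mk; rewrite leq_addl.
have k0 : (0 < k)%N by apply: leq_trans k4.
have z1 : (1 < z)%N by rewrite -[1%N]/(2 ^ 0)%N ltn_exp2l.
have Mkz : (M * k <= z)%N.
  apply: leq_trans (sqr_le_pow2 k4); rewrite leq_mul2r; apply/orP; right.
  by apply: leq_trans mk; rewrite leq_addr.
have [Xz|nX] := leqP (#|X| * z) n.
  apply: weaken (tprob_few_hit_small z1 Xz) _.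
  by case: (le_sum ((2 ^ (M + 4)) ^ g) (c * 2 ^ D) ((8 * c * d * g) ^ g) (2 ^ D))%N.
have [XM|MX] := leqP #|X| (M * k * n).
  apply: weaken (tprob_few_hit_medium z1 nX _ XM) _; last first.
    by case: (le_sum ((2 ^ (M + 4)) ^ g) (c * 2 ^ D) ((8 * c * d * g) ^ g) (2 ^ D))%N.
  by apply: (leq_trans XM); rewrite mulnC leq_mul2l Mkz orbT.
apply: weaken (tprob_few_hit_large z1 Mkz k0 (ltnW MX)) _.
by case: (le_sum ((2 ^ (M + 4)) ^ g) (c * 2 ^ D) ((8 * c * d * g) ^ g) (2 ^ D))%N.
Qed.

Lemma invX_scale_le (gamma : R) : 0 <= gamma -> D%:R * gamma <= g%:R ->
  (z%:R ^+ g)^-1 <= 2 ^+ g * n%:R `^ (- gamma) :> R.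
Proof.
move=> gamma0 Dg.
have z0 : 0 < z%:R :> R by rewrite ltr0n expn_gt0.
have n0 : 0 < n%:R `^ gamma :> R by rewrite powR_gt0 // ltr0n expn_gt0.
have z1 : 1 <= 2 * z%:R :> R by rewrite -natrM ler1n muln_gt0 expn_gt0.
rewrite powRN ler_pdivlMr // mulrC ler_pdivrMr ?exprn_gt0 // -exprMn.
have nz : n%:R <= (2 * z%:R) ^+ D :> R by rewrite exprMn -!natrX -natrM ler_nat le_scale_pow.
apply: (le_trans (ge0_ler_powR gamma0 _ _ nz)); rewrite ?nnegrE ?exprn_ge0 ?mulr_ge0 //.
by rewrite -powR_mulrn ?mulr_ge0 // -powRrM -powR_mulrn ?mulr_ge0 // ler_powR.
Qed.

End Regimes.

Theorem theorem2 (R : realType) (c : nat) (gamma : R) :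
  (0 < c)%N -> 0 < gamma ->
  exists beta : R, 0 < beta /\
  exists C : R, 0 < C /\
  forall (s r : nat) (X : {set key c s}),
    let n : R := (2 ^ r)%:R in
    let m : R := #|X|%:R in
    tprob R (fun T : tables c s r =>
      #|himage T X|%:R < n * (1 - (1 - n^-1) `^ (m / beta)))
    <= C * n `^ (- gamma).
Proof.
move=> c0 gamma0.
(* Since [n <= (2 * z) ^ D], taking [g >= D * gamma] turns [z ^ (- g)] into [O(n ^ (- gamma))]. *)
pose D := (4 * c + 2)%N; pose g := Num.bound (D%:R * gamma).
have Dg : D%:R * gamma <= g%:R by rewrite ltW // archi_boundP // mulr_ge0 // ltW.
have g0 : (0 < g)%N by [].
pose d := ((D + 1 + g) ^ c)%N; pose M := (4 * c * d * (D + g))%N.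
exists (4 * M)%:R; split; first by rewrite ltr0n muln_gt0 M_gt0.
pose K := ((2 ^ (M + 4)) ^ g + (c * 2 ^ D + (8 * c * d * g) ^ g + 2 ^ D))%N.
exists (K%:R * 2 ^+ g); split.
  by rewrite mulr_gt0 ?exprn_gt0 // ltr0n addn_gt0 !expn_gt0.
move=> s r X /=; apply: le_trans (tprob_few_hit R r c0 g0 X) _.
by rewrite -mulrA ler_wpM2l // (invX_scale_le r c0 g0 (ltW gamma0) Dg).
Qed.
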